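(* Let $(\rho_{st})_{0\le s\le t\le\infty}$ be a dynamic risk measure on $L^1(c)$. For every $s\le t$, the map $\rho_{st}:L^1_t(c)\to L^1_s(c)$ is continuous for the $c$-norm.
   Context: Path space: $\Omega$ is either $\mathcal C_0([0,\infty),\mathbb R^d)$ (continuous functions with $f(0)=0$, topology of uniform convergence on compact sets) or $D_0([0,\infty),\mathbb R^d)$ (càdlàg functions with $f(0)=0$, Skorokhod $J_1$ topology). For $0<t<\infty$, $\Omega_t$ is $\mathcal C_0([0,t],\mathbb R^d)$ with the uniform topology in the first case; in the second case $\Omega_t=D_0([0,t),\mathbb R^d)$ with the topology transported from $D_0([0,\infty),\mathbb R^d)$ by $x\mapsto x\circ\alpha_t^{-1}$, where $\alpha_t(u)=u/(t-u)$. $\Omega_\infty=\Omega$, and $\Omega_0$ is a one-point space. The restriction map $\Pi_t:\Omega\to\Omega_t$ is continuous and $\mathcal C_b(\Omega_t)$ (bounded continuous real functions) is identified with a subspace of $\mathcal C_b(\Omega)$ via $f\mapsto f\circ\Pi_t$. Capacity: $\mathcal P$ is a weakly relatively compact set of Borel probability measures on $\Omega$ (possibly non dominated), $1\le p<\infty$, $c(f)=\sup_{R\in\mathcal P}E_R(|f|^p)^{1/p}$ for $f\in\mathcal C_b(\Omega)$. $L^1(c)$ is the Banach space obtained by separation and completion of $\mathcal C_b(\Omega)$ for the semi-norm $c$; $L^1_t(c)$ is the closure of $\mathcal C_b(\Omega_t)$ in $L^1(c)$, $L^1_\infty(c)=L^1(c)$. Order: $X\le Y$ in $L^1(c)$ means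 that $Y-X$ is a $c$-limit of nonnegative functions in $\mathcal C_b(\Omega)$. Dynamic risk measure on $L^1(c)$: a family $(\rho_{st})_{0\le s\le t\le\infty}$, $\rho_{st}:L^1_t(c)\to L^1_s(c)$, with (i) $X\le Y\Rightarrow\rho_{st}(X)\ge\rho_{st}(Y)$; (ii) $\rho_{st}(X+Y)=\rho_{st}(X)-Y$ for $X\in L^1_t(c)$, $Y\in L^1_s(c)$; (iii) $\rho_{st}(\lambda X+(1-\lambda)Y)\le\lambda\rho_{st}(X)+(1-\lambda)\rho_{st}(Y)$ for $\lambda\in[0,1]$. *)

(* Defs.v *)
From HB Require Import structures.
From mathcomp Require Import all_boot all_order all_algebra.
From mathcomp Require Import generic_quotient ring_quotient.
From mathcomp Require Import all_classical all_reals all_analysis.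
From mathcomp Require Import measurable_realfun ring lra.

Set Implicit Arguments.
Unset Strict Implicit.
Unset Printing Implicit Defensive.

Import Order.TTheory GRing.Theory Num.Theory.
Import numFieldNormedType.Exports.

Local Open Scope classical_set_scope.
Local Open Scope ring_scope.
Local Open Scope quotient_scope.

Record seminorm (R : realType) (V : lmodType R) := Seminorm {
  seminorm_val :> V -> R ;
  seminormD : forall x y, seminorm_val (x + y) <= seminorm_val x + seminorm_val y ;
  seminormZ : forall a x, seminorm_val (a *: x) = `|a| * seminorm_val x }.

Section seminorm_theory.
Context {R : realType} {V : lmodType R} (c : seminorm V).

Lemma seminorm0 : c 0 = 0.
Proof. by rewrite -(scale0r 0) seminormZ normr0 mul0r. Qed.

Lemma seminormN x : c (- x) = c x.
Proof. by rewrite -scaleN1r seminormZ normrN1 mul1r. Qed.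

Lemma seminormB x y : c (x - y) = c (y - x).
Proof. by rewrite -seminormN opprB. Qed.

Lemma seminorm_ge0 x : 0 <= c x.
Proof.
have := seminormD c x (- x); rewrite subrr seminorm0 seminormN -mulr2n.
by rewrite pmulrn_lge0.
Qed.

Lemma seminorm_dist x y : `|c x - c y| <= c (x - y).
Proof.
have hx := seminormD c (x - y) y; rewrite subrK in hx.
have hy := seminormD c (y - x) x; rewrite subrK seminormB in hy.
rewrite ler_norml; apply/andP; split; lra.
Qed.

Lemma seminorm_tri z x y : c (x - y) <= c (x - z) + c (z - y).
Proof. by have := seminormD c (x - z) (z - y); rewrite addrA subrK. Qed.

End seminorm_theory.

Section cauchy_sequences.
Context {R : realType} {V : lmodType R} (c : seminorm V).

Definition cauchy_seqs : {pred nat -> V} :=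
  mem [set u : nat -> V | forall e, 0 < e -> exists N, forall m n,
    (N <= m)%N -> (N <= n)%N -> c (u m - u n) < e].

Lemma cauchy_seqs_submod : submod_closed cauchy_seqs.
Proof.
split=> [|a u v /set_mem hu /set_mem hv]; apply/mem_set => e e0 /=.
  by exists 0%N => m n _ _; rewrite subrr seminorm0.
have a0 : 0 < `|a| + 1 by rewrite ltr_wpDl.
have [|N hN] := hu (e / 2 / (`|a| + 1)); first by rewrite !divr_gt0.
have [|M hM] := hv (e / 2); first by rewrite divr_gt0.
exists (maxn N M) => m n; rewrite !geq_max => /andP[Nm Mm] /andP[Nn Mn].
have -> : (a *: u + v) m - (a *: u + v) n = a *: (u m - u n) + (v m - v n).
  by rewrite scalerBr opprD addrACA.
apply: le_lt_trans (seminormD _ _ _) _; rewrite seminormZ [e]splitr.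
apply: ler_ltD; last exact: hM.
have := hN _ _ Nm Nn; rewrite ltr_pdivlMr// => /ltW; apply: le_trans.
by rewrite mulrC ler_wpM2l ?seminorm_ge0// lerDl.
Qed.

HB.instance Definition _ :=
  GRing.isSubmodClosed.Build R (nat -> V) cauchy_seqs cauchy_seqs_submod.

Record cauchyseq := CauchySeq {
  cauchyseq_val :> nat -> V ; cauchyseq_valP : cauchyseq_val \in cauchy_seqs }.

HB.instance Definition _ := [isSub for cauchyseq_val].
HB.instance Definition _ := [Choice of cauchyseq by <:].
HB.instance Definition _ := [SubChoice_isSubLmodule of cauchyseq by <:].

Lemma cauchyseqP (u : cauchyseq) e : 0 < e -> exists N, forall m n,
  (N <= m)%N -> (N <= n)%N -> c (u m - u n) < e.
Proof. by move: (cauchyseq_valP u) => /set_mem; apply. Qed.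

Lemma cauchyseq_cvg (u : cauchyseq) : cvgn (fun n => c (u n)).
Proof.
apply/cauchy_cvgP/cauchy_ballP => e e0; near_simpl.
have [N hN] := cauchyseqP u e0.
exists ([set n | (N <= n)%N], [set n | (N <= n)%N]) => /=.
  by split; exists N.
by case=> m n /= [Nm Nn]; apply: le_lt_trans (seminorm_dist _ _ _) (hN _ _ Nm Nn).
Qed.

Definition null_seqs : {pred cauchyseq} :=
  mem [set u : cauchyseq | c (u n) @[n --> \oo] --> (0 : R)].

Lemma null_seqsZ a u : u \in null_seqs -> a *: u \in null_seqs.
Proof.
move=> /set_mem /= hu; apply/mem_set => /=.
under eq_fun do rewrite seminormZ.
by rewrite -(mulr0 `|a|); apply: cvgMr.
Qed.

Lemma null_seqs_zmod : zmod_closed null_seqs.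
Proof.
split=> [|u v /set_mem /= hu /set_mem /= hv]; apply/mem_set => /=.
  by under eq_fun do rewrite seminorm0; exact: cvg_cst.
apply: (@squeeze_cvgr _ _ _ _ (fun=> 0) (fun n => c (u n) + c (v n))).
- near=> n; rewrite seminorm_ge0/=.
  by apply: le_trans (seminormD _ _ _) _; rewrite seminormN.
- exact: cvg_cst.
- by rewrite -(addr0 0); apply: cvgD.
Unshelve. all: by end_near. Qed.

HB.instance Definition _ := GRing.isZmodClosed.Build cauchyseq null_seqs null_seqs_zmod.

End cauchy_sequences.
Arguments null_seqs {R V} c _.

Section completion.
Context {R : realType} {V : lmodType R} (c : seminorm V).

(* The separated completion of (V, c). *)
Definition completion : Type := Quotient.quot (null_seqs c).

HB.instance Definition _ := GRing.Zmodule.on completion.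
HB.instance Definition _ := EqQuotient.on completion.

Local Notation pi := (\pi_completion : cauchyseq c -> completion).

Lemma piB u v : pi (u - v) = pi u - pi v. Proof. exact: raddfB. Qed.
Lemma piD u v : pi (u + v) = pi u + pi v. Proof. exact: raddfD. Qed.

Lemma completion_eqP u v : pi u = pi v <-> (u - v) \in null_seqs c.
Proof. by rewrite Quotient.idealrBE; split=> [/eqP|/eqP]. Qed.

Definition completion_scale a (x : completion) : completion := pi (a *: repr x).

Lemma pi_scale a u : pi (a *: u) = completion_scale a (pi u).
Proof.
apply/completion_eqP; rewrite -scalerBr; apply: null_seqsZ.
by apply/completion_eqP; rewrite reprK.
Qed.

Lemma completion_scaleA a b x :
  completion_scale a (completion_scale b x) = completion_scale (a * b) x.
Proof. by rewrite -(reprK x) -(pi_scale b) -(pi_scale a) -(pi_scale (a * b)) scalerA. Qed.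

Lemma completion_scale1 : left_id 1 completion_scale.
Proof. by move=> x; rewrite -(reprK x) -pi_scale scale1r. Qed.

Lemma completion_scaleDr : right_distributive completion_scale +%R.
Proof.
move=> a x y; rewrite -(reprK x) -(reprK y) -piD -(pi_scale a (_ + _)).
by rewrite -(pi_scale a (repr x)) -(pi_scale a (repr y)) scalerDr piD.
Qed.

Lemma completion_scaleDl x : {morph completion_scale^~ x : a b / a + b}.
Proof. by move=> a b; rewrite -(reprK x) -(pi_scale a) -(pi_scale b) -(pi_scale (a + b)) scalerDl piD. Qed.

HB.instance Definition _ := GRing.Zmodule_isLmodule.Build R completion
  completion_scaleA completion_scale1 completion_scaleDr completion_scaleDl.

Definition completion_norm (x : completion) : R :=
  limn (fun n => c ((repr x : cauchyseq c) n)).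

Lemma completion_norm_pi u : completion_norm (pi u) = limn (fun n => c (u n)).
Proof.
have /completion_eqP/set_mem/= uv : pi (repr (pi u)) = pi u by rewrite reprK.
rewrite /completion_norm; set v := repr _ in uv *.
apply/eqP; rewrite -subr_eq0 -limB; [|exact: cauchyseq_cvg..].
apply/eqP/cvg_lim => //; apply/norm_cvg0P.
apply: squeeze_cvgr (cvg_cst _) uv.
by near=> n; rewrite normr_ge0 seminorm_dist.
Unshelve. all: by end_near. Qed.

Lemma completion_normD x y :
  completion_norm (x + y) <= completion_norm x + completion_norm y.
Proof.
rewrite -(reprK x) -(reprK y) -piD !completion_norm_pi.
rewrite -limD; [|exact: cauchyseq_cvg..].
apply: ler_lim; first exact: cauchyseq_cvg.
  by apply: is_cvgD; exact: cauchyseq_cvg.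
by near=> n; exact: seminormD.
Unshelve. all: by end_near. Qed.

Lemma completion_normZ a x :
  completion_norm (a *: x) = `|a| * completion_norm x.
Proof.
rewrite -(reprK x) -[_ *: _]pi_scale !completion_norm_pi.
under eq_fun do rewrite seminormZ.
apply/cvg_lim => //; apply: cvgMr; exact: cauchyseq_cvg.
Qed.

Lemma completion_norm0_eq0 x : completion_norm x = 0 -> x = 0.
Proof.
rewrite -(reprK x) completion_norm_pi => x0.
rewrite -[0](raddf0 pi); apply/completion_eqP; rewrite subr0.
by apply/mem_set => /=; rewrite -x0; exact: cauchyseq_cvg.
Qed.

HB.instance Definition _ := Lmodule_isNormed.Build R completion
  completion_normD completion_normZ completion_norm0_eq0.

Lemma cst_cauchy (v : V) : (fun=> v) \in cauchy_seqs c.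
Proof.
by apply/mem_set => e e0; exists 0%N => m n _ _; rewrite subrr seminorm0.
Qed.

(* The canonical map from V to its completion; it need not be injective. *)
Definition completion_in (v : V) : completion := pi (CauchySeq (cst_cauchy v)).

Lemma completion_in_linear : linear completion_in.
Proof.
move=> a u v; rewrite /completion_in.
transitivity (pi (a *: CauchySeq (cst_cauchy u) + CauchySeq (cst_cauchy v))).
  by congr pi; exact: val_inj.
by rewrite piD pi_scale.
Qed.

HB.instance Definition _ :=
  GRing.isLinear.Build R V completion *:%R completion_in completion_in_linear.

Lemma norm_completion_in v : `|completion_in v| = c v.
Proof. by rewrite [LHS]completion_norm_pi; apply/cvg_lim => //=; apply: cvg_cst. Qed.

Lemma completion_in_approx x e : 0 < e -> exists v, `|x - completion_in v| < e.
Proof.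
move=> e0; have [|N hN] := cauchyseqP (repr x) (e := e / 2).
  by rewrite divr_gt0.
exists ((repr x : cauchyseq c) N).
rewrite -{1}(reprK x) -piB [X in X < _]completion_norm_pi.
apply: (@le_lt_trans _ _ (e / 2)); last lra.
apply: limr_le; first exact: cauchyseq_cvg.
by exists N => // n /= Nn; exact/ltW/hN.
Qed.

Lemma completion_in_dense : closure (range completion_in) = setT.
Proof.
apply/seteqP; split=> // x _ B /nbhs_ballP[e /= e0 xB].
have [v xv] := completion_in_approx x e0.
by exists (completion_in v); split; [exists v|apply: xB; rewrite -ball_normE].
Qed.

Lemma completion_complete (F : set_system completion) :
  ProperFilter F -> cauchy F -> cvg F.
Proof.
move=> FF /cauchyP Fc.
have /choice[v hv] : forall n, exists v, F (ball (completion_in v) n.+1%:R^-1).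
  move=> n; have n0 : 0 < (n.+1%:R^-1 / 2 : R) by rewrite divr_gt0// invr_gt0.
  have [x Fx] := Fc _ n0; have [v xv] := completion_in_approx x n0.
  exists v; apply: filterS Fx => y; rewrite -!ball_normE /= => xy.
  apply: le_lt_trans (ler_distD x _ _) _; rewrite [ltRHS]splitr.
  by apply: ltrD => //; rewrite distrC.
have vd m n : c (v m - v n) < m.+1%:R^-1 + n.+1%:R^-1.
  have [y []] := filter_ex (filterI (hv m) (hv n)).
  rewrite -!ball_normE /= => my ny; rewrite -norm_completion_in linearB/=.
  apply: le_lt_trans (ler_distD y _ _) _.
  by apply: ltrD => //; rewrite distrC.
have vc : v \in cauchy_seqs c.
  apply/mem_set => e e0.
  have [N _ hN] := near_infty_natSinv_lt (PosNum (divr_gt0 e0 (ltr0n R 2))).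
  exists N => m n /hN Nm /hN Nn; apply: lt_trans (vd m n) _.
  by rewrite [ltRHS]splitr; exact: ltrD.
pose x := pi (CauchySeq vc).
have xv n : `|x - completion_in (v n)| <= n.+1%:R^-1.
  apply/ler_addgt0Pl => e e0; rewrite -piB [leLHS]completion_norm_pi.
  apply: limr_le; first exact: cauchyseq_cvg.
  have [N _ hN] := near_infty_natSinv_lt (PosNum e0).
  exists N => // m /hN Nm; apply/ltW; rewrite /= seminormB.
  by apply: lt_le_trans (vd n m) _; rewrite addrC lerD2r; exact: ltW.
apply/cvg_ex; exists x; apply/cvgrPdist_lt => e e0.
have [N _ hN] := near_infty_natSinv_lt (PosNum (divr_gt0 e0 (ltr0n R 2))).
have /= {}hN := hN _ (leqnn N).
apply: filterS (hv N) => y; rewrite -ball_normE /= => Ny.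
apply: le_lt_trans (ler_distD (completion_in (v N)) _ _) _.
rewrite [e]splitr; apply: ltr_leD; last exact/ltW/(lt_trans Ny).
exact: le_lt_trans (xv N) hN.
Qed.

HB.instance Definition _ := Uniform_isComplete.Build completion completion_complete.

End completion.

Section bounded_continuous_functions.
Context (R : realType) (T : topologicalType).

Definition bounded_continuous : {pred T -> R} :=
  mem [set f : T -> R | continuous f /\ exists M, forall x, `|f x| <= M].

Lemma bounded_continuous_submod : submod_closed bounded_continuous.
Proof.
split=> [|a f g /set_mem[fc [M fM]] /set_mem[gc [N gN]]]; apply/mem_set; split.
- by move=> x; exact: cvg_cst.
- by exists 0 => x; rewrite normr0.
- by move=> x; apply: cvgD; [apply: cvgZr; exact: fc|exact: gc].
- exists (`|a| * M + N) => x; apply: le_trans (ler_normD _ _) _.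
  by apply: lerD => //; rewrite normrZ ler_wpM2l.
Qed.

HB.instance Definition _ :=
  GRing.isSubmodClosed.Build R (T -> R) bounded_continuous bounded_continuous_submod.

Record Cb := MkCb { Cb_fun :> T -> R ; Cb_funP : Cb_fun \in bounded_continuous }.

HB.instance Definition _ := [isSub for Cb_fun].
HB.instance Definition _ := [Choice of Cb by <:].
HB.instance Definition _ := [SubChoice_isSubLmodule of Cb by <:].

Lemma Cb_continuous (f : Cb) : continuous f.
Proof. by have /set_mem[] := Cb_funP f. Qed.

Lemma Cb_bounded (f : Cb) : exists M, forall x, `|f x| <= M.
Proof. by have /set_mem[] := Cb_funP f. Qed.

End bounded_continuous_functions.

Definition borel (T : ptopologicalType) := g_sigma_algebraType (@open T).

(* The weak (narrow) topology: the coarsest one making Q |-> E_Q[f] continuous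
   for every bounded continuous f. *)
Definition weak_probability (R : realType) (T : ptopologicalType) : topologicalType :=
  initial_topology (fun Q : probability (borel T) R =>
    (fun f : Cb R T => \int[Q]_x (f x : R)) : {ptws Cb R T -> R}).

Definition weakly_relatively_compact (R : realType) (T : ptopologicalType)
    (P : set (probability (borel T) R)) : Prop :=
  precompact (P : set (weak_probability R T)).


Lemma Cb_measurable (R : realType) (T : ptopologicalType) (f : Cb R T) :
  measurable_fun [set: borel T] (f : borel T -> R).
Proof.
apply: (measurability _ (RGenOInfty.measurableE R)) => _ [_ [a ->] <-].
rewrite setTI; apply: sub_sigma_algebra; apply: open_comp => [x _|].
  exact: Cb_continuous.
exact: rray_open.
Qed.

Section capacity.
Context (R : realType) (T : ptopologicalType) (p : R) (p1 : 1 <= p).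
Implicit Types (f g : Cb R T) (Q : probability (borel T) R).

Definition moment Q f : R := (\int[Q]_x (`|f x| `^ p : R)) `^ p^-1.

Let p0 : 0 < p. Proof. exact: lt_le_trans p1. Qed.

Let momentE Q f : moment Q f = fine ('N[Q]_p%:E[EFin \o (f : borel T -> R)])%E.
Proof. by rewrite unlock fine_poweR. Qed.

Let measurable_normX f :
  measurable_fun setT (fun x : borel T => `|f x| `^ p : R).
Proof.
apply: (@measurableT_comp _ _ _ _ _ _ (@powR R ^~ p)) => //.
by apply: measurableT_comp => //; exact: Cb_measurable.
Qed.

Let Lnorm_le M Q f : (forall x, `|f x| <= M) ->
  ('N[Q]_p%:E[EFin \o (f : borel T -> R)] <= M%:E)%E.
Proof.
move=> fM; have M0 : 0 <= M by apply: le_trans (fM point).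
rewrite unlock; apply: (@le_trans _ _ ((\int[Q]_x (M `^ p)%:E) `^ p^-1)%E).
  apply: gt0_ler_poweR.
  - by rewrite invr_ge0 ltW.
  - by rewrite in_itv/= leey andbT; apply: integral_ge0 => x _; rewrite lee_fin powR_ge0.
  - by rewrite in_itv/= leey andbT; apply: integral_ge0 => x _; rewrite lee_fin powR_ge0.
  - apply: ge0_le_integral => //.
    + by move=> x _; rewrite lee_fin powR_ge0.
    + exact/measurable_EFinP.
    + by move=> x _; rewrite lee_fin ge0_ler_powR ?(ltW p0) ?nnegrE.
rewrite integral_cst// [X in (_ * X)%E](_ : _ = 1%E) ?mule1; last first.
  exact: probability_setT.
rewrite poweR_EFin -powRrM mulfV ?gt_eqF//.
by rewrite powRr1.
Qed.

Let Lnorm_fin Q f : ('N[Q]_p%:E[EFin \o (f : borel T -> R)])%E \is a fin_num.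
Proof.
have [M fM] := Cb_bounded f.
by rewrite ge0_fin_numE ?Lnorm_ge0//; apply: le_lt_trans (Lnorm_le Q fM) (ltry _).
Qed.

Lemma moment_bounded M Q f : (forall x, `|f x| <= M) -> moment Q f <= M.
Proof. by move=> fM; rewrite momentE -lee_fin fineK// Lnorm_le. Qed.

Lemma momentD Q f g : moment Q (f + g) <= moment Q f + moment Q g.
Proof.
rewrite !momentE -fineD ?Lnorm_fin// fine_le ?fin_numD ?Lnorm_fin//.
by apply: minkowski_EFin => //; exact: Cb_measurable.
Qed.

Lemma momentZ Q a f : moment Q (a *: f) = `|a| * moment Q f.
Proof.
rewrite !momentE -[`|a|]/(fine `|a|%:E) -fineM//; congr fine; rewrite unlock.
under eq_integral do rewrite /= normrM powRM// EFinM.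
rewrite ge0_integralZl_EFin ?powR_ge0//; last exact/measurable_EFinP.
rewrite poweRM ?lee_fin ?powR_ge0//; last first.
  by apply: integral_ge0 => x _; rewrite lee_fin powR_ge0.
by rewrite poweR_EFin -powRrM mulfV ?gt_eqF// powRr1.
Qed.

Variable P : set (probability (borel T) R).

Definition capacity_fun f : R := sup [set moment Q f | Q in P].

Let moment_le_capacity Q f : P Q -> moment Q f <= capacity_fun f.
Proof.
move=> PQ; have [M fM] := Cb_bounded f.
apply: ub_le_sup; last by exists Q.
by exists M => _ [Q' _ <-]; exact: moment_bounded.
Qed.

Let capacity_ge0 f : 0 <= capacity_fun f.
Proof.
have [P0|/set0P[Q PQ]] := eqVneq P set0.
  by rewrite /capacity_fun P0 image_set0 sup0.
exact: le_trans (powR_ge0 _ _) (moment_le_capacity f PQ).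
Qed.

Let capacity_le f M :
  0 <= M -> (forall Q, P Q -> moment Q f <= M) -> capacity_fun f <= M.
Proof.
move=> M0 fM; have [P0|/set0P[Q PQ]] := eqVneq P set0.
  by rewrite /capacity_fun P0 image_set0 sup0.
apply: ge_sup; first by exists (moment Q f); exists Q.
by move=> _ [Q' PQ' <-]; exact: fM.
Qed.

Lemma capacityD f g : capacity_fun (f + g) <= capacity_fun f + capacity_fun g.
Proof.
apply: capacity_le => [|Q PQ]; first exact: addr_ge0.
by apply: le_trans (momentD _ _ _) _; apply: lerD; exact: moment_le_capacity.
Qed.

Let capacityZ_le a f : capacity_fun (a *: f) <= `|a| * capacity_fun f.
Proof.
apply: capacity_le => [|Q PQ]; first exact: mulr_ge0.
by rewrite momentZ ler_wpM2l// moment_le_capacity.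
Qed.

Lemma capacityZ a f : capacity_fun (a *: f) = `|a| * capacity_fun f.
Proof.
apply/eqP; rewrite eq_le capacityZ_le/=.
have [->|a0] := eqVneq a 0; first by rewrite normr0 mul0r.
rewrite -ler_pdivlMl ?normr_gt0// -normfV.
by have := capacityZ_le a^-1 (a *: f); rewrite scalerK.
Qed.

Definition capacity : seminorm (Cb R T) := Seminorm capacityD capacityZ.

Definition L1 : completeNormedModType R := completion capacity.

End capacity.

Section paths.
Context (R : realType) (d : nat).
Local Notation E := 'rV[R]_d.
Implicit Types I J : set R.

Definition null_at_0 I (x : I -> E) := forall s : I, \val s = 0 -> x s = 0.

Definition cadlag I (x : I -> E) := forall s : I,
  x u @[u --> within [set u : I | \val s < \val u] (nbhs s)] --> x s /\
  exists l : E, x u @[u --> within [set u : I | \val u < \val s] (nbhs s)] --> l.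

Definition C0 I : Type := set_type [set x : I -> E | continuous x /\ null_at_0 x].

Definition D0 I : Type := set_type [set x : I -> E | cadlag x /\ null_at_0 x].

Lemma null_path_C0 I : [set x : I -> E | continuous x /\ null_at_0 x] (fun=> 0).
Proof. by split=> //; exact: cst_continuous. Qed.

Lemma null_path_D0 I : [set x : I -> E | cadlag x /\ null_at_0 x] (fun=> 0).
Proof. by split=> // s; split; [|exists 0]; apply: cvg_cst. Qed.

HB.instance Definition _ I := Choice.on (C0 I).
HB.instance Definition _ I := isPointed.Build (C0 I) (SigSub (mem_set (@null_path_C0 I))).
HB.instance Definition _ I := Choice.on (D0 I).
HB.instance Definition _ I := isPointed.Build (D0 I) (SigSub (mem_set (@null_path_D0 I))).

Definition increasing_map I J (phi : I -> J) :=
  forall u v : I, \val u < \val v -> \val (phi u) < \val (phi v).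

Lemma null_at_0_comp I J (phi : I -> J) (x : J -> E) :
  (forall s : I, \val s = 0 -> \val (phi s) = 0) -> null_at_0 x -> null_at_0 (x \o phi).
Proof. by move=> phi0 x0 s /phi0/x0. Qed.

Lemma cadlag_comp I J (phi : I -> J) (x : J -> E) :
  continuous phi -> increasing_map phi -> cadlag x -> cadlag (x \o phi).
Proof.
move=> phic phii xc s; have [xr [l xl]] := xc (phi s); split; [|exists l].
- move=> B /xr hB.
  have : nbhs s (phi @^-1` [set v | \val (phi s) < \val v -> B (x v)]) by exact: phic.
  by apply: filterS => u /= h su; exact/h/phii.
- move=> B /xl hB.
  have : nbhs s (phi @^-1` [set v | \val v < \val (phi s) -> B (x v)]) by exact: phic.
  by apply: filterS => u /= h su; exact/h/phii.
Qed.

Definition C0_comp I J (phi : I -> J) (phic : continuous phi)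
    (phi0 : forall s : I, \val s = 0 -> \val (phi s) = 0) (x : C0 J) : C0 I :=
  SigSub (mem_set (conj (fun s => continuous_comp (phic s) ((set_valP x).1 (phi s)))
                        (null_at_0_comp phi0 (set_valP x).2))).

Definition D0_comp I J (phi : I -> J) (phic : continuous phi)
    (phii : increasing_map phi)
    (phi0 : forall s : I, \val s = 0 -> \val (phi s) = 0) (x : D0 J) : D0 I :=
  SigSub (mem_set (conj (cadlag_comp phic phii (set_valP x).1)
                        (null_at_0_comp phi0 (set_valP x).2))).

Definition halfline : set R := `[0, +oo[%classic.
Definition segment (t : R) : set R := `[0, t]%classic.
Definition halfopen (t : R) : set R := `[0, t[%classic.

Definition C0_infty := initial_topology (fun x : C0 halfline =>
  (\val x : {family compact, halfline -> E})).

Definition C0_upto (t : R) := initial_topology (fun x : C0 (segment t) =>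
  (\val x : {uniform segment t -> E})).

HB.instance Definition _ := Topological.on C0_infty.
HB.instance Definition _ := Pointed.on C0_infty.
HB.instance Definition _ t := Topological.on (C0_upto t).
HB.instance Definition _ t := Pointed.on (C0_upto t).

Definition time_change (lam : halfline -> halfline) :=
  [/\ continuous lam, increasing_map lam & forall v, exists u, lam u = v].

(* These sets form a neighbourhood base (nbhs_skorokhodE) of the J1 topology:
   x_n -> x iff there are time changes lam_n with sup_s |lam_n s - s| -> 0 and,
   for every N, sup_(s <= N) |x_n (lam_n s) - x s| -> 0. *)
Definition skorokhod_ball (x : D0 halfline) (N e : R) : set (D0 halfline) :=
  [set y | exists2 lam, time_change lam &
    forall s : halfline, `|\val (lam s) - \val s| < e /\
      (\val s <= N -> `|\val y (lam s) - \val x s| < e)].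

Definition skorokhod_open : set_system (D0 halfline) :=
  [set O | forall x, O x -> exists N e, 0 < e /\ skorokhod_ball x N e `<=` O].

Lemma skorokhod_openT : skorokhod_open setT.
Proof. by move=> x _; exists 0, 1; split. Qed.

Lemma skorokhod_openI : setI_closed skorokhod_open.
Proof.
move=> A B hA hB x [/hA[N [e [e0 NeA]]] /hB[M [f [f0 MfB]]]].
exists (Num.max N M), (Num.min e f); split; first by rewrite lt_min e0.
by move=> y [lam lamt h]; split; [apply: NeA|apply: MfB]; exists lam => // s;
  have [h1 h2] := h s; (split=> [|sN]; last have := h2 _);
  move: h1; rewrite ?lt_min ?le_max ?sN ?orbT => /andP[? ?] // /(_ isT)/andP[].
Qed.

Lemma skorokhod_open_bigU (I : Type) (f : I -> set (D0 halfline)) :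
  (forall i, skorokhod_open (f i)) -> skorokhod_open (\bigcup_i f i).
Proof.
move=> fo x [i _ /fo[N [e [e0 h]]]]; exists N, e; split=> // y /h fy.
by exists i.
Qed.

(* D0 on [0, +oo[ with the Skorokhod J1 topology. *)
Definition D0_infty := D0 halfline.

HB.instance Definition _ := Pointed.on D0_infty.
HB.instance Definition _ := isOpenTopological.Build D0_infty
  skorokhod_openT skorokhod_openI skorokhod_open_bigU.

Lemma skorokhod_ball_center (x : D0 halfline) N e : 0 < e -> skorokhod_ball x N e x.
Proof.
move=> e0; exists id; last by move=> s; rewrite !subrr !normr0.
by split; [move=> s; exact: cvg_id|by []|by move=> v; exists v].
Qed.

Lemma skorokhod_ball_triangle (x y : D0 halfline) N e : e <= 1 ->
  skorokhod_ball x N e y -> skorokhod_ball y (N + 1) e `<=` skorokhod_ball x N (e + e).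
Proof.
move=> e1 [lam [lamc lami lams] hxy] z [mu [muc mui mus] hyz]; exists (mu \o lam).
  split.
  - by move=> s; apply: continuous_comp; [exact: lamc|exact: muc].
  - by move=> u v /lami/mui.
  - by move=> v; have [u <-] := mus v; have [w <-] := lams u; exists w.
move=> s; have [h1 h2] := hxy s; have [h3 h4] := hyz (lam s); split.
  by apply: le_lt_trans (ler_distD (\val (lam s)) _ _) _; exact: ltrD.
move=> sN; apply: le_lt_trans (ler_distD (\val y (lam s)) _ _) _.
apply: ltrD (h2 sN); apply: h4; move: h1; rewrite ltr_norml => /andP[_ h].
by move: sN e1 h; lra.
Qed.

Lemma nbhs_skorokhodE (x : D0_infty) (A : set D0_infty) :
  nbhs x A <-> exists N e, 0 < e /\ skorokhod_ball x N e `<=` A.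
Proof.
rewrite nbhsE; split=> [[U [oU Ux] UA] | [N [e [e0 NeA]]]].
  by have [N [e [e0 NeU]]] := oU x Ux; exists N, e; split=> //; exact: subset_trans UA.
exists [set y | exists N' e', 0 < e' /\ skorokhod_ball y N' e' `<=` A]; last first.
  by move=> y [N' [e' [e'0 h]]]; apply: h; exact: skorokhod_ball_center.
split; last by exists N, e.
move=> y [N' [e' [e'0 h]]]; pose f := Num.min (e' / 2) 1.
have f0 : 0 < f by rewrite lt_min ltr01 divr_gt0.
exists N', f; split=> // z yz; exists (N' + 1), f; split=> //.
have f1 : f <= 1 by rewrite ge_min lexx orbT.
have fe : f <= e' / 2 by rewrite ge_min lexx.
have fe' : f + f <= e' by rewrite [leRHS]splitr lerD.
move=> w /(skorokhod_ball_triangle f1 yz)[lam lamt hl]; apply: h; exists lam => // s.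
have [h1 h2] := hl s; split=> [|/h2 h3]; exact: lt_le_trans fe'.
Qed.

(* alpha t : [0, t[ -> [0, +oo[, the homeomorphism u |-> u / (t - u). *)
Definition alpha (t : R) (u : halfopen t) : halfline.
Proof.
exists (\val u / (t - \val u)); apply/mem_set.
have := set_valP u; rewrite /halfopen/halfline/= !in_itv/= => /andP[u0 ut].
by rewrite andbT divr_ge0// subr_ge0 ltW.
Defined.

Let val_continuous I : continuous (fun u : I => \val u : R).
Proof. exact: (@initial_continuous I R set_val). Qed.

Lemma alpha_continuous t : continuous (@alpha t).
Proof.
apply: continuous_comp_initial => u.
have := set_valP u; rewrite /halfopen/= in_itv/= => /andP[u0 ut].
apply: (@cvgM _ _ (nbhs u)); first exact: val_continuous.
apply: cvgV; first by rewrite subr_eq0 gt_eqF.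
by apply: cvgB; [exact: cvg_cst|exact: val_continuous].
Qed.

Lemma alpha_increasing t : increasing_map (@alpha t).
Proof.
move=> u v uv /=.
have := set_valP u; rewrite /halfopen/= in_itv/= => /andP[u0 ut].
have := set_valP v; rewrite /halfopen/= in_itv/= => /andP[v0 vt].
rewrite ltr_pdivrMr ?subr_gt0// mulrAC ltr_pdivlMr ?subr_gt0//.
by rewrite !mulrBr (mulrC (\val v) (\val u)) ltrD2r ltr_pM2r ?(le_lt_trans u0).
Qed.

Lemma alpha0 t (u : halfopen t) : \val u = 0 -> \val (alpha u) = 0.
Proof. by move=> /= ->; rewrite mul0r. Qed.

Definition D0_alpha t : D0_infty -> D0 (halfopen t) :=
  D0_comp (@alpha_continuous t) (@alpha_increasing t) (@alpha0 t).

(* The topology of D0 on [0, t[ transported from D0_infty along the bijection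
   x |-> x \o (alpha t)^-1, whose inverse is D0_alpha t: a set is open when its
   image under that bijection, i.e. its preimage under D0_alpha t, is. *)
Definition D0_before_open t : set_system (D0 (halfopen t)) :=
  [set O | open (@D0_alpha t @^-1` O)].

Definition D0_before (t : R) := D0 (halfopen t).

Lemma D0_before_openT t : D0_before_open (@setT (D0 (halfopen t))).
Proof. exact: openT. Qed.

Lemma D0_before_openI t : setI_closed (@D0_before_open t).
Proof. by move=> A B; exact: openI. Qed.

Lemma D0_before_open_bigU t (I : Type) (f : I -> set (D0 (halfopen t))) :
  (forall i, D0_before_open (f i)) -> D0_before_open (\bigcup_i f i).
Proof.
by move=> fo; rewrite /D0_before_open/= preimage_bigcup; apply: bigcup_open => i _; exact: fo.
Qed.

HB.instance Definition _ t := Pointed.on (D0_before t).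
HB.instance Definition _ t := isOpenTopological.Build (D0_before t)
  (@D0_before_openT t) (@D0_before_openI t) (@D0_before_open_bigU t).

Lemma segment_halfline t : segment t `<=` halfline.
Proof. by move=> u; rewrite /segment/halfline/= !in_itv/= andbT => /andP[]. Qed.

Lemma halfopen_halfline t : halfopen t `<=` halfline.
Proof. by move=> u; rewrite /halfopen/halfline/= !in_itv/= andbT => /andP[]. Qed.

Lemma subfun_continuous I J (IJ : I `<=` J) : continuous (subfun IJ).
Proof. by apply: continuous_comp_initial; exact: initial_continuous. Qed.

Lemma subfun_increasing I J (IJ : I `<=` J) : increasing_map (subfun IJ).
Proof. by []. Qed.

Lemma subfun0 I J (IJ : I `<=` J) (u : I) : \val u = 0 -> \val (subfun IJ u) = 0.
Proof. by []. Qed.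

Inductive path_kind := continuous_paths | cadlag_paths.

Definition Omega (k : path_kind) : ptopologicalType :=
  match k with
  | continuous_paths => C0_infty
  | cadlag_paths => D0_infty
  end.

(* Only times t in [0, +oo] are meaningful; for t = 0 both kinds give a
   one-point space, the path spaces over [0, 0] and over the empty set. *)
Definition Omega_ (k : path_kind) (t : \bar R) : ptopologicalType :=
  match t, k with
  | r%:E, continuous_paths => C0_upto r
  | r%:E, cadlag_paths => D0_before r
  | _, _ => Omega k
  end.

Definition Pi (k : path_kind) (t : \bar R) : Omega k -> Omega_ k t :=
  match t, k return Omega k -> Omega_ k t with
  | r%:E, continuous_paths =>
      C0_comp (@subfun_continuous _ _ (@segment_halfline r)) (@subfun0 _ _ _)
  | r%:E, cadlag_paths =>
      D0_comp (@subfun_continuous _ _ (@halfopen_halfline r)) (@subfun_increasing _ _ _)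
        (@subfun0 _ _ _)
  | _, _ => id
  end.

End paths.

Section dynamic_risk_measures.
Context (R : realType) (d : nat) (k : path_kind) (p : R) (p1 : 1 <= p).
Variable P : set (probability (borel (Omega R d k)) R).
Local Notation L1 := (L1 p1 P).

(* C_b(Omega_t), seen inside C_b(Omega). *)
Definition Cb_upto (t : \bar R) : set (Cb R (Omega R d k)) :=
  [set f | exists g : Cb R (Omega_ d k t), forall w, f w = g (Pi t w)].

Definition L1_upto (t : \bar R) : set L1 :=
  closure [set completion_in (capacity p1 P) f | f in Cb_upto t].

Definition L1_le (X Y : L1) : Prop :=
  exists u : nat -> Cb R (Omega R d k), (forall n w, 0 <= u n w) /\
    completion_in (capacity p1 P) (u n) @[n --> \oo] --> Y - X.

(* rho s t is only meaningful for 0 <= s <= t <= +oo and on L1_upto t. *)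
Record dynamic_risk_measure (rho : \bar R -> \bar R -> L1 -> L1) : Prop := {
  drm_in : forall s t, (0 <= s)%E -> (s <= t)%E ->
    forall X, L1_upto t X -> L1_upto s (rho s t X) ;
  drm_monotone : forall s t, (0 <= s)%E -> (s <= t)%E ->
    forall X Y, L1_upto t X -> L1_upto t Y ->
    L1_le X Y -> L1_le (rho s t Y) (rho s t X) ;
  drm_translation : forall s t, (0 <= s)%E -> (s <= t)%E ->
    forall X Y, L1_upto t X -> L1_upto s Y ->
    rho s t (X + Y) = rho s t X - Y ;
  drm_convex : forall s t, (0 <= s)%E -> (s <= t)%E ->
    forall X Y, L1_upto t X -> L1_upto t Y ->
    forall lambda : R, 0 <= lambda <= 1 ->
    L1_le (rho s t (lambda *: X + (1 - lambda) *: Y))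
          (lambda *: rho s t X + (1 - lambda) *: rho s t Y) }.

End dynamic_risk_measures.

(* Main.v *)
Require Import Defs.
From mathcomp Require Import all_boot all_order all_algebra.
From mathcomp Require Import all_classical all_reals all_analysis.
From mathcomp Require Import lra.
Import Order.TTheory GRing.Theory Num.Theory.
Import numFieldNormedType.Exports.
Local Open Scope classical_set_scope.
Local Open Scope ring_scope.

(** * Sequential closure, and continuity of antitone convex maps *)

Lemma closure_seqP (R : realType) (V : normedModType R) (A : set V) (x : V) :
  closure A x <->
  exists2 u : nat -> V, (forall n, A (u n)) & u n @[n --> \oo] --> x.
Proof.
split=> [Ax|[u Au ux]]; last first.
  apply: (closed_cvg (closure A)) ux; first exact: closed_closure.
  by near=> n; apply: subset_closure.
have /choice[u hu] n : exists v, A v /\ `|x - v| < n.+1%:R^-1.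
  have [|v [Av]] := Ax (ball x (n.+1%:R^-1 : R)).
    by apply: nbhsx_ballx; rewrite invr_gt0.
  by rewrite -ball_normE /= => xv; exists v.
exists u => [n|]; first by case: (hu n).
apply/cvgrPdist_lt => e e0.
have [N _ hN] := near_infty_natSinv_lt (PosNum e0).
by exists N => // n /hN /=; apply: lt_trans; case: (hu n).
Unshelve. all: by end_near. Qed.

(* By contradiction, let h n -> 0 rapidly with increments of phi along h n bounded
   away from 0, and let k n dominate both h n and - h n with comparable norm. Then
   S = \sum_n 2 ^ n *: k n converges and both h n and - h n lie below 2 ^- n *: S.
   By monotonicity and convexity the increment of phi along h n is at most 2 ^- n
   times the fixed increment along - S. *)
Lemma antitone_convex_continuous (R : realType) (V : completeNormedModType R)
    (W : normedModType R) (E C : set V) (C' : set W) (phi : V -> W) :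
  closed E -> (forall a x y, E x -> E y -> E (a *: x + y)) ->
  closed C -> C 0 -> (forall x y, C x -> C y -> C (x + y)) ->
  (forall (a : R) x, 0 <= a -> C x -> C (a *: x)) ->
  (forall x, E x -> exists k, [/\ E k, C (k - x), C (k + x) & `|k| <= `|x| ]) ->
  (forall x y, C' x -> C' y -> C' (x + y)) ->
  (forall (a : R) x, 0 <= a -> C' x -> C' (a *: x)) ->
  (forall x y, C' (y - x) -> C' (y + x) -> `|x| <= `|y|) ->
  (forall x y, E x -> E y -> C (y - x) -> C' (phi x - phi y)) ->
  (forall x y, E x -> E y -> forall a : R, 0 <= a <= 1 ->
    C' (a *: phi x + (1 - a) *: phi y - phi (a *: x + (1 - a) *: y))) ->
  {within E, continuous phi}.
Proof.
move=> clE linE clC C0 CD CZ domE C'D C'Z normC' anti conv.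
apply/subspace_continuousP => x Ex; apply/cvgrPdist_lt => e e0; near_simpl.
apply: contrapT => far.
have ED u v : E u -> E v -> E (u + v).
  by move=> Eu Ev; rewrite -[u]scale1r; exact: linE.
have E0 : E 0 by rewrite -(addNr x) -scaleN1r; exact: linE.
have EZ a u : E u -> E (a *: u) by move=> Eu; rewrite -[_ *: _]addr0; exact: linE.
have EN u : E u -> E (- u) by rewrite -scaleN1r; exact: EZ.
(* Increments from [x] vanish at 0, so convexity becomes [psi (a *: u) <= a *: psi u] in the order
   of [C'], for [a] in [0, 1]. *)
pose psi u := phi (x + u) - phi x.
have psi_anti u v : E u -> E v -> C (v - u) -> C' (psi u - psi v).
  move=> Eu Ev uv; rewrite /psi opprB addrA subrK.
  by apply: anti; [exact: ED..|rewrite opprD addrACA subrr add0r].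
have psi_conv (a : R) u : 0 <= a <= 1 -> E u -> C' (a *: psi u - psi (a *: u)).
  move=> a01 Eu; have := conv (x + u) x (ED _ _ Ex Eu) Ex a a01.
  have -> : a *: (x + u) + (1 - a) *: x = x + a *: u.
    by rewrite scalerDr addrAC -scalerDl subrKC scale1r.
  rewrite /psi; congr C'; rewrite opprB scalerBr scalerBl scale1r.
  by rewrite (addrC (phi x) (- (a *: _))) !addrA.
(* [x] is the midpoint of [x + u] and [x - u], so an upper bound on [psi (- u)] is also one on
   [- psi u]. *)
have psi_sym u : E u -> C' (psi u + psi (- u)).
  move=> Eu.
  have h01 : 0 <= (2^-1 : R) <= 1 by lra.
  have h2 : 1 - 2^-1 = 2^-1 :> R by lra.
  have := conv _ _ (ED _ _ Ex Eu) (ED _ _ Ex (EN _ Eu)) _ h01.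
  have -> : 2^-1 *: (x + u) + (1 - 2^-1) *: (x - u) = x.
    rewrite h2 -scalerDr addrACA subrr addr0 -mulr2n -(scaler_nat 2 x) scalerA.
    by rewrite mulVf ?scale1r.
  move=> /(C'Z 2 _ (ler0n _ _)); rewrite h2 -scalerDr scalerBr scalerA mulfV//.
  by rewrite scale1r scaler_nat mulr2n opprD addrACA.
(* The radius 4 ^- n still leaves 2 ^- n after the weight 2 ^ n in [a n], so a geometric series
   dominates the norms and completeness of [V] yields [S]. *)
have /choice[h hP] n : exists u,
    [/\ E u, `|u| < 2^-1 ^+ n * 2^-1 ^+ n & e <= `|psi u| ].
  apply: contrapT => no; apply: far.
  rewrite near_withinE; apply/nbhs_normP.
  exists (2^-1 ^+ n * 2^-1 ^+ n) => /=; first by rewrite mulr_gt0.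
  move=> y /= xy Ey; rewrite ltNge; apply/negP => ey; apply: no.
  exists (y - x); split; first by exact/ED/EN.
    by rewrite distrC.
  by rewrite /psi subrKC distrC.
have /choice[k kP] n : exists u,
    [/\ E u, C (u - h n), C (u + h n) & `|u| <= `|h n| ].
  by apply: domE; case: (hP n).
(* [k n] is the half-sum of [k n - h n] and [k n + h n]. *)
have Ck n : C (k n).
  have [_ k1 k2 _] := kP n.
  have := CZ 2^-1 _ (ltac:(lra)) (CD _ _ k1 k2).
  rewrite addrACA addNr addr0 -mulr2n -(scaler_nat 2 (k n)) scalerA.
  by rewrite mulVf ?scale1r.
pose a n : V := 2 ^+ n *: k n.
have Sa : cvgn (series a).
  apply: normed_cvg.
  apply: (series_le_cvg _ _ _ (@is_cvg_geometric_series R 1 2^-1 _)) => [n|n|n|].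
  - exact: normr_ge0.
  - by rewrite /geometric /= mul1r.
  - rewrite /geometric /= mul1r /a normrZ ger0_norm//.
    have [_ hn _] := hP n; have [_ _ _ kn] := kP n.
    rewrite -ler_pdivlMl// -exprVn; exact/ltW/(le_lt_trans kn).
  - by rewrite ger0_norm; lra.
set S := limn (series a) in Sa.
have ES : E S.
  apply: (closed_cvg E clE) Sa; near=> m; rewrite /series /=.
  by apply: big_ind => // i _; apply: EZ; case: (kP i).
(* Once [m > n], the partial sum without its [n]-th term is a sum of elements of [C]; closedness
   carries this to the limit. *)
have CS n : C (S - a n).
  have : series a m - a n @[m --> \oo] --> S - a n.
    by apply: cvgB => //; exact: cvg_cst.
  apply: (closed_cvg C clC).
  near=> m.
  have nm : (n < m)%N by near: m; exact: nbhs_infty_gt.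
  rewrite seriesEord /= (bigD1 (Ordinal nm)) //= addrAC subrr add0r.
  by apply: big_ind => // i _; exact: CZ.
have bound n : e <= 2^-1 ^+ n * `|psi (- S)|.
  have [En _ en] := hP n; have [_ k1 k2 _] := kP n; apply: le_trans en _.
  set b : R := 2^-1 ^+ n.
  have b01 : 0 <= b <= 1 by rewrite exprn_ge0 ?exprn_ile1//; lra.
  (* The factor [b] cancels the weight 2 ^ n of [k n] inside [S]. *)
  have bS : C (b *: S - k n).
    have := CZ b _ (ltac:(by case/andP: b01)) (CS n).
    by rewrite scalerBr /a scalerA -exprMn mulVf// expr1n scale1r.
  (* Here [- (b *: S) <= - k n <= u]; antitonicity bounds [psi u] by [psi (b *: - S)], and convexity
     bounds that by [b *: psi (- S)]. *)
  have below u : E u -> C (k n + u) -> C' (b *: psi (- S) - psi u).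
    move=> Eu ku; have Sn := psi_conv _ _ b01 (EN _ ES).
    have : C' (psi (b *: - S) - psi u).
      apply: psi_anti => //; first exact/EZ/EN.
      rewrite scalerN opprK addrC.
      by have := CD _ _ bS ku; rewrite addrA subrK.
    by move=> /(C'D _ _ Sn); rewrite addrA subrK.
  rewrite -[b]ger0_norm -?normrZ; last by case/andP: b01.
  apply: normC'; first exact: below.
  (* The lower bound on [psi (h n)] comes from the upper bound on [psi (- h n)] through
     [psi_sym]. *)
  have := C'D _ _ (below _ (EN _ En) k1) (psi_sym _ En).
  by rewrite (addrC (psi (h n))) addrA subrK.
have : 2^-1 ^+ n * `|psi (- S)| @[n --> \oo] --> 0 * `|psi (- S)|.
  by apply: cvgM; [apply: cvg_expr; rewrite ger0_norm; lra|exact: cvg_cst].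
rewrite mul0r => /cvgrPdist_lt/(_ _ e0)[N _ /(_ N (leqnn N))] /=.
rewrite sub0r normrN ger0_norm ?mulr_ge0//.
by rewrite ltNge bound.
Unshelve. all: by end_near. Qed.

(** * Monotonicity of the capacity in the modulus *)

Lemma moment_le (R : realType) (T : ptopologicalType) (p : R) (p0 : 0 < p)
    (Q : probability (borel T) R) (f g : Cb R T) :
  (forall x, `|f x| <= `|g x|) -> moment p Q f <= moment p Q g.
Proof.
move=> fg.
(* Comparing real-valued integrals requires integrability, which holds for a bounded measurable
   function under a probability. *)
have norm_integrable (h : Cb R T) : Q.-integrable setT
    (EFin \o (fun x : borel T => `|h x| `^ p : R)).
  have [M hM] := Cb_bounded h.
  apply: measurable_bounded_integrable => //.
  - by rewrite [X in (X < _)%E](_ : _ = 1%E) ?ltry//; exact: probability_setT.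
  - apply: (@measurableT_comp _ _ _ _ _ _ (@powR R ^~ p)) => //.
    by apply: measurableT_comp => //; exact: Cb_measurable.
  - exists (M `^ p); split; first exact: num_real.
    move=> N MN x _; apply/ltW; apply: le_lt_trans MN.
    rewrite ger0_norm ?powR_ge0// ge0_ler_powR ?(ltW p0) ?nnegrE//.
    exact: le_trans (hM x).
apply: ge0_ler_powR; rewrite ?nnegrE.
- by rewrite invr_ge0 ltW.
- by apply: Rintegral_ge0 => x _; exact: powR_ge0.
- by apply: Rintegral_ge0 => x _; exact: powR_ge0.
- apply: le_Rintegral => // x _.
  by rewrite ge0_ler_powR ?(ltW p0) ?nnegrE.
Qed.

Lemma capacity_le (R : realType) (T : ptopologicalType) (p : R) (p1 : 1 <= p)
    (P : set (probability (borel T) R)) (f g : Cb R T) :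
  (forall x, `|f x| <= `|g x|) -> capacity p1 P f <= capacity p1 P g.
Proof.
move=> fg; change (capacity_fun p P f <= capacity_fun p P g).
(* The supremum over an empty [P] is 0 by convention; a least upper bound argument needs a point of
   [P]. *)
have [P0|/set0P[Q PQ]] := eqVneq P set0.
  have c0 h : capacity_fun p P h = 0.
    by rewrite /capacity_fun P0 (image_set0 (moment p ^~ h)) sup0.
  by rewrite !c0 lexx.
have [M gM] := Cb_bounded g.
apply: ge_sup; first by exists (moment p Q f); exists Q.
move=> _ [Q' PQ' <-].
apply: (@le_trans _ _ (moment p Q' g)).
  by apply: moment_le => //; exact: lt_le_trans p1.
apply: ub_le_sup; last by exists Q'.
by exists M => _ [Q'' _ <-]; exact: moment_bounded.
Qed.

Lemma bounded_continuous_norm {R : realType} {T : topologicalType} (f : Cb R T) :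
  (fun x => `|f x|) \in @bounded_continuous R T.
Proof.
apply/mem_set; split; last first.
  by have [M fM] := Cb_bounded f; exists M => x; rewrite normr_id.
by move=> x; apply: cvg_norm; exact: Cb_continuous.
Qed.

Definition Cb_norm {R : realType} {T : topologicalType} (f : Cb R T) : Cb R T :=
  MkCb (bounded_continuous_norm f).

(** * Order, norm and moduli in the completion *)

Section L1_order.
Context (R : realType) (d : nat) (k : path_kind) (p : R) (p1 : 1 <= p).
Context (P : set (probability (borel (Omega R d k)) R)).
Local Notation L1 := (L1 p1 P).
Local Notation inL1 := (completion_in (capacity p1 P)).

(** The positive cone of the order, written as a closure so that its closedness is immediate. *)
Definition L1_nneg : set L1 :=
  closure [set inL1 f | f in [set f : Cb R (Omega R d k) | forall w, 0 <= f w]].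

Lemma L1_leE (X Y : L1) : L1_le X Y = L1_nneg (Y - X).
Proof.
apply/propext; split=> [[u [u0 uXY]]|/closure_seqP[v vP vXY]].
  by apply/closure_seqP; exists (inL1 \o u) => // n; exists (u n) => //; exact: u0.
have /choice[u uP] n :
    exists f : Cb R (Omega R d k), (forall w, 0 <= f w) /\ inL1 f = v n.
  by have [f f0 <-] := vP n; exists f.
exists u; split=> [n|]; first by case: (uP n).
by under eq_fun do rewrite (proj2 (uP _)).
Qed.

Lemma L1_nnegD (X Y : L1) : L1_nneg X -> L1_nneg Y -> L1_nneg (X + Y).
Proof.
move=> /closure_seqP[u uP uX] /closure_seqP[v vP vY]; apply/closure_seqP.
exists (fun n => u n + v n) => [n|]; last exact: cvgD.
have [f f0 <-] := uP n; have [g g0 <-] := vP n.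
by exists (f + g) => [w|]; [exact: addr_ge0 (f0 w) (g0 w)|rewrite raddfD].
Qed.

Lemma L1_nnegZ (a : R) (X : L1) : 0 <= a -> L1_nneg X -> L1_nneg (a *: X).
Proof.
move=> a0 /closure_seqP[u uP uX]; apply/closure_seqP.
exists (fun n => a *: u n) => [n|]; last exact: cvgZr.
have [f f0 <-] := uP n.
by exists (a *: f) => [w|]; [exact: mulr_ge0 a0 (f0 w)|rewrite linearZ].
Qed.

Lemma L1_nneg0 : L1_nneg 0.
Proof. by apply: subset_closure; exists 0 => //; rewrite raddf0. Qed.

(** If nonnegative [f] and [g] approximate [Y - X] and [Y + X], then [(g - f) / 2] and [(g + f) / 2]
    approximate [X] and [Y]. Pointwise [|g - f| <= |g + f|], so monotonicity of the capacity gives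
    the bound in the limit. *)
Lemma L1_norm_le (X Y : L1) :
  L1_nneg (Y - X) -> L1_nneg (Y + X) -> `|X| <= `|Y|.
Proof.
move=> /closure_seqP[u uP uYX] /closure_seqP[v vP vYX].
have half : forall Z : L1, 2^-1 *: (Z + Z) = Z.
  by move=> Z; rewrite -mulr2n -(scaler_nat 2 Z) scalerA mulVf ?scale1r.
have cX : 2^-1 *: (v n - u n) @[n --> \oo] --> X.
  rewrite -[X in _ --> X]half; apply: cvgZr.
  have -> : X + X = (Y + X) - (Y - X) by rewrite opprB [RHS]addrC addrA subrK.
  exact: cvgB.
have cY : 2^-1 *: (v n + u n) @[n --> \oo] --> Y.
  rewrite -[X in _ --> X]half; apply: cvgZr.
  have -> : Y + Y = (Y + X) + (Y - X) by rewrite addrACA subrr addr0.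
  exact: cvgD.
apply: (ler_cvg_to (cvg_norm cX) (cvg_norm cY)); apply: nearW => n.
have [f f0 <-] := uP n; have [g g0 <-] := vP n.
rewrite !normrZ; apply: ler_wpM2l; first exact: normr_ge0.
rewrite -linearB -linearD !norm_completion_in; apply: capacity_le => w.
have norm_sub (a b : R) : 0 <= a -> 0 <= b -> `|b - a| <= `|b + a|.
  by move=> a0 b0; rewrite (ger0_norm (addr_ge0 b0 a0)) ler_norml; lra.
exact: norm_sub (f0 w) (g0 w).
Qed.

Lemma L1_upto_linear (t : \bar R) (a : R) (X Y : L1) :
  L1_upto t X -> L1_upto t Y -> L1_upto t (a *: X + Y).
Proof.
move=> /closure_seqP[u uP uX] /closure_seqP[v vP vY]; apply/closure_seqP.
exists (fun n => a *: u n + v n) => [n|]; last by apply: cvgD => //; exact: cvgZr.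
have [f [f' ff'] <-] := uP n; have [g [g' gg'] <-] := vP n.
exists (a *: f + g); last by rewrite linearP.
by exists (a *: f' + g') => w; rewrite -[LHS]/(a * f w + g w) ff' gg'.
Qed.

(* The witness is the modulus of X, the limit of the moduli of approximants. *)
Lemma L1_upto_dominated (t : \bar R) (X : L1) : L1_upto t X ->
  exists Y, [/\ L1_upto t Y, L1_nneg (Y - X), L1_nneg (Y + X) & `|Y| <= `|X| ].
Proof.
move=> /closure_seqP[u uP uX].
have /choice[f fP] n : exists f : Cb R (Omega R d k), Cb_upto t f /\ inL1 f = u n.
  by have [f ft <-] := uP n; exists f.
have {}uX : inL1 (f n) @[n --> \oo] --> X.
  by under eq_fun do rewrite (proj2 (fP _)).
pose v n := inL1 (Cb_norm (f n)).
(* By the reverse triangle inequality the modulus is 1-Lipschitz for the capacity, so [v] inherits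
   the Cauchy property. *)
have v_dist m n : `|v m - v n| <= `|inL1 (f m) - inL1 (f n)|.
  rewrite /v -!raddfB !norm_completion_in; apply: capacity_le => w.
  exact: ler_dist_dist.
have vc : cvgn v.
  apply/cauchy_cvgP/cauchy_ballP => e e0; near_simpl.
  have uC : cauchy (inL1 (f n) @[n --> \oo]) by apply: cvg_cauchy; exact: cvgP uX.
  have /cauchy_ballP/(_ _ e0) := uC; near_simpl.
  apply: filterS => -[m n]; rewrite -!ball_normE /=.
  exact: le_lt_trans (v_dist m n).
exists (limn v); split.
- apply/closure_seqP; exists v => // n; exists (Cb_norm (f n)) => //.
  (* Taking moduli preserves factorization through [Pi t]. *)
  have [g fg] := (fP n).1; exists (Cb_norm g) => w /=.
  by rewrite fg.
- apply/closure_seqP; exists (fun n => v n - inL1 (f n)); last exact: cvgB.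
  move=> n; exists (Cb_norm (f n) - f n); last by rewrite raddfB.
  by move=> w; rewrite subr_ge0; exact: ler_norm.
- apply/closure_seqP; exists (fun n => v n + inL1 (f n)); last exact: cvgD.
  move=> n; exists (Cb_norm (f n) + f n); last by rewrite raddfD.
  by move=> w /=; rewrite -lerBlDr sub0r -normrN; exact: ler_norm.
- apply: (ler_cvg_to (cvg_norm vc) (cvg_norm uX)); apply: nearW => n.
  rewrite !norm_completion_in; apply: capacity_le => w.
  by rewrite normr_id.
Qed.

End L1_order.

Theorem theorem2 (R : realType) (d : nat) (k : path_kind) (p : R) (p1 : 1 <= p)
    (P : set (probability (borel (Omega R d k)) R))
    (rho : \bar R -> \bar R -> L1 p1 P -> L1 p1 P) :
  weakly_relatively_compact P ->
  dynamic_risk_measure rho ->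
  forall s t : \bar R, (0 <= s)%E -> (s <= t)%E ->
  {within L1_upto t, continuous (rho s t)}.
Proof.
move=> _ drm s t s0 st.
(* [E] is the closed subspace [L1_upto t], and both cones are [L1_nneg]; [L1_leE] turns the order
   axioms into membership in this cone. *)
apply: (@antitone_convex_continuous _ _ _ _ (@L1_nneg R d k p p1 P)
  (@L1_nneg R d k p p1 P)).
- exact: closed_closure.
- by move=> a X Y; exact: L1_upto_linear.
- exact: closed_closure.
- exact: L1_nneg0.
- exact: L1_nnegD.
- exact: L1_nnegZ.
- exact: L1_upto_dominated.
- exact: L1_nnegD.
- exact: L1_nnegZ.
- exact: L1_norm_le.
- by move=> X Y Xt Yt; rewrite -!L1_leE; exact: drm_monotone drm _ _ s0 st _ _ Xt Yt.
- move=> X Y Xt Yt a a01; rewrite -L1_leE.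
  exact: drm_convex drm _ _ s0 st _ _ Xt Yt _ a01.
Qed.
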